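(* Let $n\ge1$. The class of $(\langle\ \rangle;,\mathsf A_1,\dots,\mathsf A_n,\cdot,\sqcup)$-algebras that are representable by $n$-ary partial functions is a variety, finitely axiomatised by the following equations (each universally quantified over all element variables occurring in it): (1) $\langle \boldsymbol a; b_1,\dots,\boldsymbol a; b_n\rangle ; c = \boldsymbol a;(\boldsymbol b; c)$; (2) $\boldsymbol\pi; a = a$; (3) $\langle \mathsf A_1^n a\rangle; a = 0$ (i.e. $\langle \mathsf A_1^n a\rangle; a=\langle \mathsf A_1^n b\rangle; b$ for all $a,b$, so that $0$ is a well-defined constant); (4) $\langle a_1,\dots,a_{i-1},0,a_{i+1},\dots,a_n\rangle; b = 0$ for every $i$; (5) $\boldsymbol a; 0 = 0$; (6) $\boldsymbol a;\mathsf A_i b = \langle \mathsf A_1^n(\boldsymbol a; b)\rangle;\langle \mathsf D_1^n a_1\rangle;\cdots;\langle \mathsf D_1^n a_n\rangle; a_i$ for every $i$; (7) $\langle \mathsf D_1^n a\rangle; a = a$; (8) $\mathsf A_i\mathsf A_j a=\mathsf A_i\mathsf A_k a$ for every $i,j,k$; (9) $a\cdot a=a$; (10) $a\cdot b=b\cdot a$; (11) $\boldsymbol a;(b\cdot c)=(\boldsymbol a; b)\cdot(\boldsymbol a; c)$; (12) $\langle \mathsf D_1^n(a\cdot b)\rangle; a=a\cdot b$; (13) $\langle a\bowtie_1 b,\dots,a\bowtie_n b\rangle; a=\langle a\bowtie_1 b,\dots,a\bowtie_n b\rangle; b$; (14) $\big(\boldsymbol\alpha;\mathsf D_i(\boldsymbol\alpha;(a\cdot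 b))\big) +_i \big(\boldsymbol\alpha;\langle \mathsf A_1^n(\boldsymbol\alpha; a)\rangle;\mathsf A_i(\boldsymbol\alpha; b)\big)=\boldsymbol\alpha;(a\bowtie_i b)$ for every $i$, where $\boldsymbol\alpha=\langle \mathsf A_1 d,\dots,\mathsf A_n d\rangle$ with $d$ an arbitrary element; (15) $\big(\langle \mathsf D_1^n a\rangle;(b\bowtie_i c)\big)+_i\big(\langle \mathsf A_1^n a\rangle;(b\bowtie_i c)\big)=b\bowtie_i c$ for every $i$; (16) $\langle \mathsf D_1^n a\rangle;(a\sqcup b)=a$; (17) $\langle \mathsf A_1^n a\rangle;(a\sqcup b)=\langle \mathsf A_1^n a\rangle; b$.
   Context: Fix $n\ge 1$; indices $i,j,k$ range over $\{1,\dots,n\}$. The signature has an $(n+1)$-ary operation (composition), written $\langle a_1,\dots,a_n\rangle ; b$, unary operations $\mathsf A_1,\dots,\mathsf A_n$, and binary operations $\cdot$ and $\sqcup$. Algebras are nonempty. An $n$-ary partial function on a set $X$ is a set $f\subseteq X^{n+1}$ such that $(\boldsymbol x,y),(\boldsymbol x,z)\in f$ implies $y=z$ (where $\boldsymbol x\in X^n$). An algebra of $n$-ary partial functions of this signature is an algebra whose elements are $n$-ary partial functions, for which there are a set $X$ (the base) and an equivalence relation $E$ on $X$ such that every tuple $(x_1,\dots,x_{n+1})$ in every element lies in $X^{n+1}$ and has pairwise $E$-equivalent entries, and whose operations are $\boldsymbol f; g=\{(\boldsymbol x,z)\in X^{n+1} : \exists \boldsymbol y\in X^n,\ (\boldsymbol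 x,y_i)\in f_i \text{ for each } i \text{ and } (\boldsymbol y,z)\in g\}$, $\mathsf A_i(f)=\{(\boldsymbol x,x_i)\in X^{n+1} : x_1,\dots,x_n \text{ all } E\text{-equivalent and there is no } y\in X \text{ with } (\boldsymbol x,y)\in f\}$, $f\cdot g=f\cap g$, and preferential union: $(f\sqcup g)(\boldsymbol x)$ is $f(\boldsymbol x)$ if $f(\boldsymbol x)$ is defined, $g(\boldsymbol x)$ if $f(\boldsymbol x)$ is undefined but $g(\boldsymbol x)$ is defined, and undefined otherwise. An algebra is representable by $n$-ary partial functions if it is isomorphic to an algebra of $n$-ary partial functions of the same signature. Notation: a bold symbol $\boldsymbol a$ in a term $\boldsymbol a; b$ stands for $\langle a_1,\dots,a_n\rangle$; unbracketed compositions associate to the right ($\boldsymbol a;\boldsymbol b; c=\boldsymbol a;(\boldsymbol b; c)$); for unary operations $\mathsf B_1,\dots,\mathsf B_n$, $\langle \mathsf B_1^n a\rangle$ means $\langle \mathsf B_1 a,\dots,\mathsf B_n a\rangle$. Abbreviations: $0:=\langle \mathsf A_1^n b\rangle; b$ for any $b$; $\pi_i:=\mathsf A_i 0$; $\boldsymbol\pi:=\langle\pi_1,\dots,\pi_n\rangle$; $\mathsf D_i a:=\mathsf A_i\mathsf A_i a$; $\alpha+_i\beta:=\mathsf A_i(\langle \mathsf A_1^n\alpha\rangle;\mathsf A_i\beta)$; $a\bowtie_i b:=\mathsf D_i(a\cdot b)+_i(\langle \mathsf A_1^n a\rangle;\mathsf A_i b)$. *)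

(* Defs.v *)
From mathcomp Require Import all_boot.
From Stdlib Require Import RelationClasses ClassicalEpsilon.

Set Implicit Arguments.
Unset Strict Implicit.
Unset Printing Implicit Defensive.

(* Indices 1, ..., n are the elements of 'I_n, and n-tuples over T are functions
   'I_n -> T. *)

Record algebra (n : nat) := Algebra {
  carrier :> Type;
  carrier_nonempty : inhabited carrier;
  comp : ('I_n -> carrier) -> carrier -> carrier;
  anti : 'I_n -> carrier -> carrier;
  meet : carrier -> carrier -> carrier;
  pref : carrier -> carrier -> carrier
}.

Section Homomorphisms.
Variable n : nat.

Record homomorphism (A B : algebra n) (h : A -> B) : Prop := Homomorphism {
  hom_comp : forall (a : 'I_n -> A) b,
    h (comp a b) = comp (fun i => h (a i)) (h b);
  hom_anti : forall i a, h (anti i a) = anti i (h a);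
  hom_meet : forall a b, h (meet a b) = meet (h a) (h b);
  hom_pref : forall a b, h (pref a b) = pref (h a) (h b)
}.

Definition isomorphic (A B : algebra n) : Prop :=
  exists2 h : A -> B, homomorphism h & bijective h.

End Homomorphisms.

Section Varieties.
Variable n : nat.

Lemma product_nonempty (I : Type) (A : I -> algebra n) :
  inhabited (forall i, A i).
Proof. exact (inhabits (fun i => epsilon (carrier_nonempty (A i)) xpredT)). Qed.

Definition product (I : Type) (A : I -> algebra n) : algebra n :=
  {| carrier := forall i, A i;
     carrier_nonempty := product_nonempty A;
     comp := fun a b i => comp (fun k => a k i) (b i);
     anti := fun k a i => anti k (a i);
     meet := fun a b i => meet (a i) (b i);
     pref := fun a b i => pref (a i) (b i) |}.

(* Subalgebras are taken up to isomorphism, as domains of embeddings; this is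
   harmless since closure under homomorphic images includes closure under
   isomorphism. The index type of a product may be empty. *)
Record variety (C : algebra n -> Prop) : Prop := Variety {
  variety_image : forall (A B : algebra n) (h : A -> B),
    homomorphism h -> (forall b, exists a, h a = b) -> C A -> C B;
  variety_sub : forall (A B : algebra n) (h : A -> B),
    homomorphism h -> injective h -> C B -> C A;
  variety_product : forall (I : Type) (A : I -> algebra n),
    (forall i, C (A i)) -> C (product A)
}.

End Varieties.

Section PartialFunctions.
Variables (n : nat) (X : Type).

(* Subsets of X^(n+1), a tuple being split as (x, y) with x in X^n. *)
Definition mrel := ('I_n -> X) -> X -> Prop.

Implicit Types (f g : mrel) (E : X -> X -> Prop).

Definition functional f : Prop := forall x y z, f x y -> f x z -> y = z.

Definition equiv_entries E f : Prop :=
  forall x y, f x y -> (forall i j, E (x i) (x j)) /\ (forall i, E (x i) y).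

Definition fun_comp (f : 'I_n -> mrel) g : mrel :=
  fun x z => exists y : 'I_n -> X, (forall i, f i x (y i)) /\ g y z.

Definition fun_anti E (i : 'I_n) f : mrel :=
  fun x z => [/\ z = x i, forall j k, E (x j) (x k) & ~ exists y, f x y].

Definition fun_meet f g : mrel := fun x z => f x z /\ g x z.

Definition fun_pref f g : mrel :=
  fun x z => f x z \/ (~ (exists y, f x y) /\ g x z).

End PartialFunctions.

Record function_algebra (n : nat) := FunctionAlgebra {
  base : Type;
  base_equiv : base -> base -> Prop;
  base_equivP : Equivalence base_equiv;
  elem : mrel n base -> Prop;
  elem_nonempty : exists f, elem f;
  elem_functional : forall f, elem f -> functional f;
  elem_entries : forall f, elem f -> equiv_entries base_equiv f;
  elem_comp : forall f g, (forall i, elem (f i)) -> elem g -> elem (fun_comp f g);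
  elem_anti : forall i f, elem f -> elem (fun_anti base_equiv i f);
  elem_meet : forall f g, elem f -> elem g -> elem (fun_meet f g);
  elem_pref : forall f g, elem f -> elem g -> elem (fun_pref f g)
}.

Section Representability.
Variable n : nat.

Lemma elem_inhabited (F : function_algebra n) : inhabited {f : mrel n (base F) | elem f}.
Proof. by case: (elem_nonempty F) => f Ff; exact (inhabits (exist _ f Ff)). Qed.

Definition algebra_of (F : function_algebra n) : algebra n :=
  {| carrier := {f : mrel n (base F) | elem f};
     carrier_nonempty := elem_inhabited F;
     comp := fun a b => exist _ _ (elem_comp (fun i => svalP (a i)) (svalP b));
     anti := fun i a => exist _ _ (elem_anti i (svalP a));
     meet := fun a b => exist _ _ (elem_meet (svalP a) (svalP b));
     pref := fun a b => exist _ _ (elem_pref (svalP a) (svalP b)) |}.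

Definition representable (A : algebra n) : Prop :=
  exists F : function_algebra n, isomorphic A (algebra_of F).

End Representability.

Section Equations.
Variable n : nat.

(* Countably many variables: single ones, and n-tuples of them. *)
Inductive var := Single of nat | Indexed of nat & 'I_n.

Inductive term :=
  | Var of var
  | Comp of ('I_n -> term) & term
  | Anti of 'I_n & term
  | Meet of term & term
  | Pref of term & term.

Fixpoint eval (A : algebra n) (v : var -> A) (t : term) : A :=
  match t with
  | Var x => v x
  | Comp s t => comp (fun i => eval v (s i)) (eval v t)
  | Anti i t => anti i (eval v t)
  | Meet s t => meet (eval v s) (eval v t)
  | Pref s t => pref (eval v s) (eval v t)
  end.

Definition equation := (term * term)%type.

Definition satisfies (A : algebra n) (e : equation) : Prop :=
  forall v : var -> A, eval v e.1 = eval v e.2.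

Definition axiomatised_by (C : algebra n -> Prop) (s : seq equation) : Prop :=
  forall A : algebra n, C A <-> (forall e, List.In e s -> satisfies A e).

Local Notation "s ;; t" := (Comp s t) (at level 45, right associativity).
Local Notation "s =: t" := ((s, t) : equation) (at level 70).

Definition Antis (t : term) : 'I_n -> term := fun i => Anti i t.
Definition Dom (i : 'I_n) (t : term) : term := Anti i (Anti i t).
Definition Doms (t : term) : 'I_n -> term := fun i => Dom i t.

(* The abbreviation 0 := <A_1^n z>; z is well defined only modulo axiom3; it is
   spelled with a variable z used for nothing else. *)
Definition zero : term := let z := Var (Single 4) in Antis z ;; z.
Definition proj (i : 'I_n) : term := Anti i zero.

Definition Plus (i : 'I_n) (s t : term) : term := Anti i (Antis s ;; Anti i t).
Definition Bowtie (i : 'I_n) (s t : term) : term :=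
  Plus i (Dom i (Meet s t)) (Antis s ;; Anti i t).

Let a := Var (Single 0).
Let b := Var (Single 1).
Let c := Var (Single 2).
Let d := Var (Single 3).
Let aa (i : 'I_n) := Var (Indexed 0 i).
Let bb (i : 'I_n) := Var (Indexed 1 i).

Definition axiom1 := (fun i => aa ;; bb i) ;; c =: aa ;; bb ;; c.
Definition axiom2 := proj ;; a =: a.
Definition axiom3 := Antis a ;; a =: zero.
Definition axiom4 i := (fun j => if j == i then zero else aa j) ;; b =: zero.
Definition axiom5 := aa ;; zero =: zero.
Definition axiom6 i :=
  aa ;; Anti i b =:
  Antis (aa ;; b) ;; foldr (fun j t => Doms (aa j) ;; t) (aa i) (enum 'I_n).
Definition axiom7 := Doms a ;; a =: a.
Definition axiom8 i j k := Anti i (Anti j a) =: Anti i (Anti k a).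
Definition axiom9 := Meet a a =: a.
Definition axiom10 := Meet a b =: Meet b a.
Definition axiom11 := aa ;; Meet b c =: Meet (aa ;; b) (aa ;; c).
Definition axiom12 := Doms (Meet a b) ;; a =: Meet a b.
Definition axiom13 :=
  (fun i => Bowtie i a b) ;; a =: (fun i => Bowtie i a b) ;; b.
Definition axiom14 i :=
  let alpha := Antis d in
  Plus i (alpha ;; Dom i (alpha ;; Meet a b))
         (alpha ;; Antis (alpha ;; a) ;; Anti i (alpha ;; b))
  =: alpha ;; Bowtie i a b.
Definition axiom15 i :=
  Plus i (Doms a ;; Bowtie i b c) (Antis a ;; Bowtie i b c) =: Bowtie i b c.
Definition axiom16 := Doms a ;; Pref a b =: a.
Definition axiom17 := Antis a ;; Pref a b =: Antis a ;; b.

Definition axioms : seq equation :=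
  [:: axiom1; axiom2; axiom3; axiom5; axiom7; axiom9; axiom10; axiom11;
      axiom12; axiom13; axiom16; axiom17]
  ++ [seq axiom4 i | i <- enum 'I_n]
  ++ [seq axiom6 i | i <- enum 'I_n]
  ++ [seq axiom8 ij.1 ij.2 k |
       ij <- [seq (i, j) | i <- enum 'I_n, j <- enum 'I_n], k <- enum 'I_n]
  ++ [seq axiom14 i | i <- enum 'I_n]
  ++ [seq axiom15 i | i <- enum 'I_n].

End Equations.

(* Main.v *)
From mathcomp Require Import all_boot boolp classical_sets.
From Stdlib Require Import ClassicalEpsilon.
Require Import Defs.

(** A class defined by equations is closed under images, subalgebras and
    products, so everything rests on the axiomatisation.

    Soundness. Every value of [anti] is a partial projection [pid i P], the
    [i]-th projection restricted to a set [P] of tuples, and composing with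
    [<pid 1 P, ..., pid n P>] restricts a function to [P]. The terms occurring
    in the axioms thereby become Boolean combinations of domains; in
    particular [fun_bowtie i f g] is [pid i] of the set where [f] and [g]
    agree, in the sense that both are undefined or both are defined with equal
    values ([fun_bowtieE]).

    Completeness. In a model [A], let [off d] be the operator on [A] that in
    the intended models restricts to the complement of the domain of [d].
    These operators are idempotent and commute ([off_idem], [offC]), and
    elements that agree both off and on the domain of some [d] are equal
    ([off_cases]). The latter comes from the axioms on [bowtie]: if [x] and [y]
    agree on each of two complementary parts, then so do [bowtie i x y] and
    [bowtie i x x], which is the [i]-th projection; hence [bowtie i x y] is
    the projection itself, and composing it with [x] or with [y] gives the
    same result.

    For a set [Z] of elements, thought of as those undefined at some abstract
    point, [eqv Z x y] holds when finitely many [off d] with [d] in [Z] make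
    [x] and [y] equal. For a suitable [Z], called a prime ideal, the
    [eqv Z]-classes of elements outside [Z] carry a representation in which
    [a] sends the classes of [f_1, ..., f_n] to the class of [comp f a], and is
    undefined when that element lies in [Z]. The disjoint union of these
    representations over all prime ideals, two points being equivalent when
    they belong to the same ideal, represents [A] ([theta]). It is faithful:
    given [x <> y], Zorn's lemma yields a maximal [Z] with [~ eqv Z x y]; by
    [off_cases] it is prime ([prime_separation]), and the images of [x] and [y]
    then differ at the tuple of projections ([theta_inj]). *)

Set Implicit Arguments.
Unset Strict Implicit.
Unset Printing Implicit Defensive.

(** * Equations and varieties *)

Section Satisfaction.
Variable n : nat.

Lemma hom_eval (A B : algebra n) (h : A -> B) (v : var n -> A) (t : term n) :
  homomorphism h -> h (eval v t) = eval (fun x => h (v x)) t.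
Proof.
move=> hh; elim: t => //= [s IHs t IHt|i t IHt|s IHs t IHt|s IHs t IHt].
- by rewrite (hom_comp hh) IHt; congr comp; apply: funext.
- by rewrite (hom_anti hh) IHt.
- by rewrite (hom_meet hh) IHs IHt.
- by rewrite (hom_pref hh) IHs IHt.
Qed.

Lemma satisfies_sub (A B : algebra n) (h : A -> B) (e : equation n) :
  homomorphism h -> injective h -> satisfies B e -> satisfies A e.
Proof. by move=> hh injh Be v; apply: injh; rewrite !hom_eval. Qed.

Lemma satisfies_image (A B : algebra n) (h : A -> B) (e : equation n) :
  homomorphism h -> (forall b, exists a, h a = b) ->
  satisfies A e -> satisfies B e.
Proof.
move=> hh surjh Ae v.
have [w hw] := boolp.choice (P := fun x a => h a = v x) (fun x => surjh (v x)).
have -> : v = (fun x => h (w x)) by apply: funext => x; rewrite hw.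
by rewrite -!hom_eval // Ae.
Qed.

Lemma satisfies_product (I : Type) (A : I -> algebra n) (e : equation n) :
  (forall i, satisfies (A i) e) -> satisfies (product A) e.
Proof.
move=> Ae v; apply: functional_extensionality_dep => i.
have ev t : eval v t i = eval (fun x => v x i) t.
  by apply: (hom_eval (h := fun f : product A => f i)); split.
by rewrite !ev; exact: Ae.
Qed.

Lemma axiomatised_variety (C : algebra n -> Prop) (s : seq (equation n)) :
  axiomatised_by C s -> variety C.
Proof.
move=> Cs; split.
- move=> A B h hh surjh /Cs As; apply/Cs => e /As.
  exact: satisfies_image surjh.
- by move=> A B h hh injh /Cs Bs; apply/Cs => e /Bs; apply: satisfies_sub injh.
- move=> I A CA; apply/Cs => e es; apply: satisfies_product => i.
  exact: (proj1 (Cs (A i))).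
Qed.

Lemma In_catP (T : Type) (P : T -> Prop) (s t : seq T) :
  (forall e, List.In e (s ++ t) -> P e) <->
  (forall e, List.In e s -> P e) /\ (forall e, List.In e t -> P e).
Proof.
split=> [Pst|[Ps Pt] e est]; last first.
  by case: (List.in_app_or _ _ _ est) => [/Ps|/Pt].
by split=> e es; apply: Pst; apply: List.in_or_app; [left|right].
Qed.

Lemma In_mapP (S : eqType) (T : Type) (f : S -> T) (P : T -> Prop) (s : seq S) :
  (forall e, List.In e (map f s) -> P e) <-> (forall x, x \in s -> P (f x)).
Proof.
elim: s => [|y s IHs] /=; first by split.
split=> [Pfs x|Pfs e [<-|es]].
- rewrite inE => /predU1P[->|xs]; first by apply: Pfs; left.
  by apply: (proj1 IHs) xs => e es; apply: Pfs; right.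
- by apply: Pfs; rewrite inE eqxx.
- by apply: (proj2 IHs) es => x xs; apply: Pfs; rewrite inE xs orbT.
Qed.

Lemma In_enumP (S : finType) (T : Type) (f : S -> T) (P : T -> Prop) :
  (forall e, List.In e [seq f x | x <- enum S] -> P e) <-> (forall x, P (f x)).
Proof.
split; first by move=> /In_mapP Pf x; apply: Pf; rewrite mem_enum.
by move=> Pf; apply/In_mapP.
Qed.

(** Splits the list of axioms into its members, so that both directions of the
    axiomatisation can treat them one at a time. *)
Lemma axiomsP (P : equation n -> Prop) :
  (forall e, List.In e (axioms n) -> P e) <->
  [/\ [/\ P (axiom1 n), P (axiom2 n), P (axiom3 n), P (axiom5 n) &
          P (axiom7 n)],
      [/\ P (axiom9 n), P (axiom10 n), P (axiom11 n), P (axiom12 n) &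
          P (axiom13 n)],
      [/\ P (axiom16 n), P (axiom17 n), forall i, P (axiom4 i) &
          forall i, P (axiom6 i)] &
      [/\ forall i j k : 'I_n, P (axiom8 i j k),
          forall i, P (axiom14 i) & forall i, P (axiom15 i)]].
Proof.
rewrite /axioms !In_catP !In_enumP.
have -> : [seq axiom8 ij.1 ij.2 k |
       ij <- [seq (i, j) | i <- enum 'I_n, j <- enum 'I_n], k <- enum 'I_n] =
  [seq axiom8 p.1.1 p.1.2 p.2 | p <- [seq (ij, k) |
    ij <- [seq (i, j) | i <- enum 'I_n, j <- enum 'I_n], k <- enum 'I_n]].
  exact/esym/(map_allpairs (fun p => axiom8 p.1.1 p.1.2 p.2) pair).
rewrite In_mapP; split.
- case=> P0 [P4 [P6 [P8 [P14 P15]]]]; split; split=> //;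
    try by apply: P0; rewrite /=; tauto.
  move=> i j k; apply: (P8 ((i, j), k)).
  apply/allpairsP; exists ((i, j), k); rewrite mem_enum; split=> //.
  by apply/allpairsP; exists (i, j); rewrite !mem_enum.
- case=> [[P1 P2 P3 P5 P7] [P9 P10 P11 P12 P13] [P16 P17 P4 P6] [P8 P14 P15]].
  by do !split=> //; move=> e; rewrite /=; intuition; subst e.
Qed.

End Satisfaction.

Lemma mrel_ext (n : nat) (X : Type) (f g : mrel n X) :
  (forall x z, f x z <-> g x z) -> f = g.
Proof. by move=> fg; do 2!apply: funext => ?; apply: propext. Qed.

(** * Restriction operators in a model *)

Section Model.
Variables (n : nat) (n_gt0 : 0 < n) (A : algebra n).
Hypothesis axA : forall e, List.In e (axioms n) -> satisfies A e.

Implicit Types (a b c d e x y : A) (i j k : 'I_n) (s t u : seq A).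
Implicit Types (f g : 'I_n -> A).

(** In the intended models, [off d x] is [x] restricted to the tuples at which
    [d] is undefined, and [on d x] is [x] restricted to the domain of [d]. *)
Definition off d x : A := comp (fun i => anti i d) x.
Definition on d x : A := comp (fun i => anti i (anti i d)) x.

(** The constant 0. By [off_self] the choice of [d] does not matter. *)
Definition zr : A := let d := epsilon (carrier_nonempty A) xpredT in off d d.

(** The variables of the axioms are some single ones, listed in [s], and the
    tuples [f] and [g]. The default of [nth] is the element that defines [zr],
    so that the term [zero], whose variable lies beyond all the lists used
    below, evaluates to [zr]. *)
Definition valuation s f g (x : var n) : A :=
  match x with
  | Single k => nth (epsilon (carrier_nonempty A) xpredT) s k
  | Indexed k i => if k is 0 then f i else g i
  end.

(* A filler for the tuples that an axiom does not mention. *)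
Let e0 : 'I_n -> A := fun=> zr.

Lemma compA f g a : comp (fun i => comp f (g i)) a = comp f (comp g a).
Proof.
have [[H _ _ _ _] _ _ _] := proj1 (axiomsP _) axA.
exact: (H (valuation [:: a; a; a] f g)).
Qed.

Lemma comp_proj a : comp (fun i => anti i zr) a = a.
Proof.
have [[_ H _ _ _] _ _ _] := proj1 (axiomsP _) axA.
exact: (H (valuation [:: a] e0 e0)).
Qed.

Lemma off_self a : off a a = zr.
Proof.
have [[_ _ H _ _] _ _ _] := proj1 (axiomsP _) axA.
exact: (H (valuation [:: a] e0 e0)).
Qed.

Lemma comp0 f : comp f zr = zr.
Proof.
have [[_ _ _ H _] _ _ _] := proj1 (axiomsP _) axA.
exact: (H (valuation [::] f e0)).
Qed.

Lemma on_self a : on a a = a.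
Proof.
have [[_ _ _ _ H] _ _ _] := proj1 (axiomsP _) axA.
exact: (H (valuation [:: a] e0 e0)).
Qed.

Lemma meetxx a : meet a a = a.
Proof.
have [_ [H _ _ _ _] _ _] := proj1 (axiomsP _) axA.
exact: (H (valuation [:: a] e0 e0)).
Qed.

Lemma meetC a b : meet a b = meet b a.
Proof.
have [_ [_ H _ _ _] _ _] := proj1 (axiomsP _) axA.
exact: (H (valuation [:: a; b] e0 e0)).
Qed.

Lemma comp_meet f a b : comp f (meet a b) = meet (comp f a) (comp f b).
Proof.
have [_ [_ _ H _ _] _ _] := proj1 (axiomsP _) axA.
exact: (H (valuation [:: a; a; b] f e0)).
Qed.

Lemma on_meet a b : on (meet a b) a = meet a b.
Proof.
have [_ [_ _ _ H _] _ _] := proj1 (axiomsP _) axA.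
exact: (H (valuation [:: a; b] e0 e0)).
Qed.

Lemma on_pref a b : on a (pref a b) = a.
Proof.
have [_ _ [H _ _ _] _] := proj1 (axiomsP _) axA.
exact: (H (valuation [:: a; b] e0 e0)).
Qed.

Lemma off_pref a b : off a (pref a b) = off a b.
Proof.
have [_ _ [_ H _ _] _] := proj1 (axiomsP _) axA.
exact: (H (valuation [:: a; b] e0 e0)).
Qed.

Lemma comp_zr_at f i a : f i = zr -> comp f a = zr.
Proof.
move=> fi; have [_ _ [_ _ H _] _] := proj1 (axiomsP _) axA.
rewrite -[RHS](H i (valuation [:: a; a] f e0)) /=; congr comp.
by apply: funext => j; case: eqP => // ->.
Qed.

Lemma comp_anti f i a :
  comp f (anti i a) =
  off (comp f a)
    (foldr (fun j x => on (f j) x) (f i) (enum 'I_n)).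
Proof.
have [_ _ [_ _ _ H] _] := proj1 (axiomsP _) axA.
have /= -> := H i (valuation [:: a; a] f e0); congr comp.
by elim: (enum _) => //= j l ->.
Qed.

Lemma anti_antiC i j k a : anti i (anti j a) = anti i (anti k a).
Proof.
have [_ _ _ [H _ _]] := proj1 (axiomsP _) axA.
exact: (H i j k (valuation [:: a] e0 e0)).
Qed.

Definition plus i x y : A := anti i (off x (anti i y)).
Definition bowtie i x y : A :=
  plus i (anti i (anti i (meet x y))) (off x (anti i y)).

Lemma comp_bowtie a b :
  comp (fun i => bowtie i a b) a = comp (fun i => bowtie i a b) b.
Proof.
have [_ [_ _ _ _ H] _ _] := proj1 (axiomsP _) axA.
exact: (H (valuation [:: a; b] e0 e0)).
Qed.

Lemma off_bowtie i d a b :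
  off d (bowtie i a b) =
  plus i (off d (anti i (anti i (off d (meet a b)))))
         (off d (off (off d a) (anti i (off d b)))).
Proof.
have [_ _ _ [_ H _]] := proj1 (axiomsP _) axA.
exact: (esym (H i (valuation [:: a; b; a; d] e0 e0))).
Qed.

Lemma bowtie_split i d a b :
  plus i (on d (bowtie i a b)) (off d (bowtie i a b)) = bowtie i a b.
Proof.
have [_ _ _ [_ _ H]] := proj1 (axiomsP _) axA.
exact: (H i (valuation [:: d; a; b] e0 e0)).
Qed.

(** Restriction to a domain is restriction off the complementary domain, and
    it does not matter which of the [anti i] provides the complement. *)
Lemma onE i a x : on a x = off (anti i a) x.
Proof. by congr comp; apply: funext => j; exact: anti_antiC. Qed.

Lemma off0 x : off zr x = x.
Proof. exact: comp_proj. Qed.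

Lemma off_comp d f x : off d (comp f x) = comp (fun i => off d (f i)) x.
Proof. by rewrite /off compA. Qed.

Lemma off_meet d x y : off d (meet x y) = meet (off d x) (off d y).
Proof. exact: comp_meet. Qed.

(** The axiom on [comp f (anti i b)] when [f] is [<A_1 d, ..., A_n d>]: the
    domain restrictions [on (anti j d)] collapse, since each of them is equal
    to [on (anti i d)], which fixes [anti i d]. *)
Lemma off_anti d b i : off d (anti i b) = off (off d b) (anti i d).
Proof.
rewrite {1}/off comp_anti; congr off.
elim: (enum _) => //= j l ->; rewrite /on.
have -> : (fun k => anti k (anti k (anti j d))) =
          (fun k => anti k (anti k (anti i d))).
  by apply: funext => k; congr anti; exact: anti_antiC.
exact: on_self.
Qed.

Lemma off_off d b x : off d (off b x) = off (off d b) (off d x).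
Proof.
rewrite {2}/off off_comp [RHS]off_comp; congr comp.
by apply: funext => i; rewrite off_anti.
Qed.

Lemma off_idem d x : off d (off d x) = off d x.
Proof. by rewrite off_off off_self off0. Qed.

Lemma off_anti_self d i : off d (anti i d) = anti i d.
Proof. by rewrite off_anti off_self off0. Qed.

Lemma bowtiexx i a : bowtie i a a = anti i zr.
Proof. by rewrite /bowtie meetxx off_anti_self /plus off_self. Qed.

Lemma off_bowtie_eq i d a b :
  off d a = off d b -> off d (bowtie i a b) = off d (anti i zr).
Proof.
by move=> ab; rewrite -(bowtiexx i b) !off_bowtie !off_meet ab.
Qed.

(** Case distinction on the domain of [d]. On each part [bowtie j x y]
    coincides with [bowtie j x x], so [bowtie_split] reassembles the former to
    the latter, the [j]-th projection. *)
Lemma off_cases i d x y :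
  off d x = off d y -> off (anti i d) x = off (anti i d) y -> x = y.
Proof.
move=> xy xy'.
have bow j : bowtie j x y = anti j zr.
  rewrite -(bowtie_split j d) (onE i) !off_bowtie_eq //.
  by rewrite -(bowtiexx j x) -(onE i) bowtie_split.
have := comp_bowtie x y.
have -> : (fun j => bowtie j x y) = (fun j => anti j zr) by apply: funext.
by rewrite !comp_proj.
Qed.

Lemma off_anti_anti i j d : off (anti i d) (anti j d) = zr.
Proof.
rewrite -(off_self (anti j d)); congr comp.
by apply: funext => k; exact: anti_antiC.
Qed.

(** By cases on the domain of [d]: off it both sides become
    [off (off d b) (anti i d)], and on it both vanish. *)
Lemma off_antiC d b i : off d (anti i b) = off b (anti i d).
Proof.
apply: (off_cases (i := i) (d := d)).
- by rewrite off_idem off_off off_anti_self off_anti.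
- rewrite [RHS]off_off off_self {3}/off comp0 {2}/off off_comp.
  by apply: (comp_zr_at _ (i := i)); exact: off_anti_anti.
Qed.

Lemma offC d b x : off d (off b x) = off b (off d x).
Proof.
rewrite {2 4}/off !off_comp; congr comp.
by apply: funext => i; rewrite off_antiC.
Qed.

Lemma off_anti_off i d x : off (anti i d) (off d x) = zr.
Proof.
rewrite {2}/off off_comp; apply: (comp_zr_at _ (i := i)).
exact: off_anti_anti.
Qed.

(** * Equality off finitely many domains *)

Definition offs s x := foldr off x s.

Lemma offs_comp s f x : offs s (comp f x) = comp (fun i => offs s (f i)) x.
Proof. by elim: s => //= d s ->; rewrite off_comp. Qed.

Lemma offs_meet s x y : offs s (meet x y) = meet (offs s x) (offs s y).
Proof. by elim: s => //= d s ->; rewrite off_meet. Qed.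

Lemma offs_cat s t x : offs (s ++ t) x = offs s (offs t x).
Proof. exact: foldr_cat. Qed.

Lemma off_offs d s x : off d (offs s x) = offs s (off d x).
Proof. by elim: s => //= e s IHs; rewrite offC IHs. Qed.

Lemma offs_off s d x : offs s (off d x) = off (offs s d) (offs s x).
Proof. by elim: s => //= e s ->; rewrite off_off. Qed.

Lemma offs_absorb s t x : List.incl s t -> offs t (offs s x) = offs t x.
Proof.
have absorb1 d y : List.In d t -> offs t (off d y) = offs t y.
  elim: t => //= e t IHt [->|/IHt ->//].
  by rewrite -off_offs off_idem.
elim: s => //= d s IHs dst; rewrite absorb1; last by apply: dst; left.
by apply: IHs => e es; apply: dst; right.
Qed.

Lemma offs_incl s t x y :
  List.incl s t -> offs s x = offs s y -> offs t x = offs t y.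
Proof. by move=> st xy; rewrite -(offs_absorb x st) xy offs_absorb. Qed.

Lemma offs_catl s t x y :
  offs s x = offs s y -> offs (s ++ t) x = offs (s ++ t) y.
Proof. by apply/offs_incl/List.incl_appl; exact: List.incl_refl. Qed.

Lemma offs_catr s t x y :
  offs t x = offs t y -> offs (s ++ t) x = offs (s ++ t) y.
Proof. by apply/offs_incl/List.incl_appr; exact: List.incl_refl. Qed.

Implicit Types Z : A -> Prop.

(** If [Z] is an ideal of domains, this says that [x] and [y] agree off the
    domain of one element of [Z]. Finite lists take the place of joins of
    elements, so that [eqv Z] is an equivalence for arbitrary [Z] and Zorn's
    lemma can be applied to sets without any closure condition. *)
Definition eqv Z x y : Prop :=
  exists2 s, (forall d, List.In d s -> Z d) & offs s x = offs s y.

Lemma eqv_refl Z x : eqv Z x x.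
Proof. by exists [::]. Qed.

Lemma eqv_sym Z x y : eqv Z x y -> eqv Z y x.
Proof. by case=> s sZ xy; exists s. Qed.

Lemma eqv_trans Z x y z : eqv Z x y -> eqv Z y z -> eqv Z x z.
Proof.
case=> s sZ xy [t tZ yz]; exists (s ++ t).
  by move=> d /List.in_app_iff[/sZ|/tZ].
by rewrite (offs_catl t xy) (offs_catr s yz).
Qed.

(** Finitely many witnesses, one for each argument, are merged into one. *)
Lemma eqv_comp Z f g x :
  (forall i, eqv Z (f i) (g i)) -> eqv Z (comp f x) (comp g x).
Proof.
move=> fg.
have [s sZ sfg] : exists2 s, (forall d, List.In d s -> Z d) &
    forall i, i \in enum 'I_n -> offs s (f i) = offs s (g i).
  elim: (enum 'I_n) => [|i l [s sZ sfg]]; first by exists [::].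
  have [t tZ tfg] := fg i; exists (s ++ t).
    by move=> d /List.in_app_iff[/sZ|/tZ].
  move=> j; rewrite inE => /predU1P[->|jl].
    exact: offs_catr.
  by apply: offs_catl; exact: sfg.
exists s => //; rewrite !offs_comp; congr comp; apply: funext => i.
by apply: sfg; rewrite mem_enum.
Qed.

Lemma eqv_meet Z x y : eqv Z x y -> eqv Z (meet x y) x.
Proof. by case=> s sZ xy; exists s; rewrite // offs_meet -xy meetxx. Qed.

Lemma off_eqv Z d x : Z d -> eqv Z (off d x) x.
Proof. by move=> Zd; exists [:: d] => [e [<-//|]|] //=; rewrite off_idem. Qed.

(** * Prime ideals of domains *)

(** The elements undefined at a point: exactly one of [d] and [anti i d] is
    undefined there, and so is everything that the point cannot tell from 0.
    The second condition implies that [Z] contains whatever has a smaller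
    domain than one of its members. *)
Record prime_ideal Z : Prop := Prime {
  prime_anti : forall i d, Z (anti i d) <-> ~ Z d;
  prime_zr : forall d, eqv Z d zr -> Z d
}.

Section Separation.
Variables x y : A.
Hypothesis xy : x <> y.

(** A maximal [Z] that keeps [x] and [y] apart exists since [eqv] has finite
    character. Adding to it any [d] outside identifies [x] and [y], and the
    finitely many other elements used lie in [Z]. *)
Lemma separating_max : exists2 Z, ~ eqv Z x y &
  forall d, ~ Z d -> exists2 s, (forall e, List.In e s -> Z e) &
    off d (offs s x) = off d (offs s y).
Proof.
have chain (F : set (set A)) : (F `<=` [set Z | ~ eqv Z x y])%classic ->
    total_on F subset -> ~ eqv (\bigcup_(Z in F) Z)%classic x y.
  move=> Fxy Ftot [s sF sxy].
  (* The empty chain has an empty union, hence the case of an empty list. *)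
  suff [s0|[Z FZ sZ]] : s = [::] \/ exists2 Z, F Z &
      forall d, List.In d s -> Z d.
  - by move: sxy; rewrite s0.
  - by apply: (Fxy Z FZ); exists s.
  elim: s {sxy} sF => [|d s IHs] sF; first by left.
  right; have [W FW Wd] : (\bigcup_(Z in F) Z)%classic d by apply: sF; left.
  have [e es|s0|[Z FZ sZ]] := IHs; first by apply: sF; right.
    by exists W; rewrite // s0 => e [<-|].
  have [ZW|WZ] := Ftot Z W FZ FW.
    by exists W => // e [<-//|/sZ]; apply: ZW.
  by exists Z => // e [<-|/sZ//]; apply: WZ.
have [Z [Zxy Zmax]] := Zorn_bigcup chain; exists Z => // d Zd.
have [s sZ sxy] : eqv (fun e => Z e \/ e = d) x y.
  apply: contrapT; apply: Zmax; split; first by move=> e; left.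
  by move=> /(_ d) ZZd; apply/Zd/ZZd; right.
suff [t tZ st] : exists2 t, (forall e, List.In e t -> Z e) &
    List.incl s (d :: t).
  by exists t => //; exact: (offs_incl st sxy).
elim: s sZ {sxy} => [|e s IHs] sZ; first by exists [::].
have [e' es|t tZ st] := IHs; first by apply: sZ; right.
have [Ze|->] := sZ e (or_introl erefl).
  exists (e :: t) => [e' [<-//|/tZ//]|e' [<-|/st]] /=; tauto.
by exists t => // e' [<-|/st//]; left.
Qed.

(** If both [d] and [anti i d] were outside the maximal [Z], then [x] and [y]
    would agree on both parts of a case distinction, off some members of [Z];
    if both were inside, all elements would be equivalent to 0. *)
Lemma prime_separation : exists2 Z, prime_ideal Z & ~ eqv Z x y.
Proof.
have [Z Zxy Zmax] := separating_max; exists Z => //; split=> [i d|d].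
- split=> [Zd' Zd|Zd].
    apply: Zxy; exists [:: anti i d; d] => [e [<-|[<-|]]|] //=.
    by rewrite !off_anti_off.
  apply: contrapT => Zd'; apply: Zxy.
  have [s sZ sxy] := Zmax _ Zd; have [t tZ txy] := Zmax _ Zd'.
  exists (s ++ t); first by move=> e /List.in_app_iff[/sZ|/tZ].
  apply: (off_cases (i := i) (d := d)); rewrite !off_offs.
    by apply: offs_catl; rewrite -!off_offs.
  by apply: offs_catr; rewrite -!off_offs.
- case=> s sZ; rewrite (_ : offs s zr = zr) => [s0|]; last first.
    by elim: s {sZ} => //= e s ->; exact: comp0.
  apply: contrapT => Zd; apply: Zxy; have [t tZ txy] := Zmax _ Zd.
  exists (s ++ t); first by move=> e /List.in_app_iff[/sZ|/tZ].
  (* As [s] kills [d], restricting off [d] has no effect off [s]. *)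
  rewrite !offs_cat -[LHS]off0 -[RHS]off0 -s0 -!offs_off.
  by rewrite txy.
Qed.

End Separation.

Section PrimeIdeal.
Variable Z : A -> Prop.
Hypothesis primeZ : prime_ideal Z.

Let i0 : 'I_n := Ordinal n_gt0.

Lemma mem_prime d : Z d <-> eqv Z d zr.
Proof.
split=> [Zd|]; last exact: prime_zr.
by exists [:: d] => [e [<-//|]|] //=; rewrite off_self /off comp0.
Qed.

Lemma prime_eqv x y : eqv Z x y -> Z x -> Z y.
Proof.
move=> xy /mem_prime x0; apply/mem_prime.
by apply: eqv_trans x0; apply: eqv_sym.
Qed.

Lemma on_eqv d x : ~ Z d -> eqv Z (on d x) x.
Proof.
by move=> Zd; rewrite (onE i0); apply: off_eqv; apply/(prime_anti primeZ).
Qed.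

Lemma prime_off d x : ~ Z d -> Z (off d x).
Proof.
move=> Zd; apply: (prime_zr primeZ); exists [:: anti i0 d] => [e [<-|]|] //=.
  exact/(prime_anti primeZ).
by rewrite off_anti_off /off comp0.
Qed.

Lemma prime_comp f x i : Z (f i) -> Z (comp f x).
Proof.
move=> /mem_prime Zfi; apply/mem_prime.
pose g j := if j == i then zr else f j.
rewrite -(comp_zr_at (f := g) (i := i) x); last by rewrite /g eqxx.
apply: eqv_comp => j; rewrite /g; case: eqP => [->//|_]; exact: eqv_refl.
Qed.

(** [anti i a] acts as a projection where [a] is undefined, all the arguments
    being defined; elsewhere it is undefined ([comp_anti_out]). *)
Lemma comp_anti_in f i a :
  (forall j, ~ Z (f j)) -> Z (comp f a) -> eqv Z (comp f (anti i a)) (f i).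
Proof.
move=> Zf Zfa; rewrite comp_anti; apply: eqv_trans (off_eqv _ Zfa) _.
elim: (enum _) => [|j l IHl] /=; first exact: eqv_refl.
exact: eqv_trans (on_eqv _ (Zf j)) IHl.
Qed.

Lemma comp_anti_out f i a : ~ Z (comp f a) -> Z (comp f (anti i a)).
Proof. by move=> Zfa; rewrite comp_anti; apply: prime_off. Qed.

(** Inserting [on a] between the arguments and [pref a b] does not affect the
    class when [a] is defined at [f], by the lemmas on [anti] applied twice. *)
Lemma comp_pref_out f a b :
  ~ Z (comp f a) -> eqv Z (comp f (pref a b)) (comp f a).
Proof.
move=> Zfa; have Zf j : ~ Z (f j) by move=> /(prime_comp a).
rewrite -{2}(on_pref a b) /on -compA; apply: eqv_comp => j; apply: eqv_sym.
by apply: comp_anti_in => //; apply: comp_anti_out.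
Qed.

Lemma comp_pref_in f a b : (forall j, ~ Z (f j)) -> Z (comp f a) ->
  eqv Z (comp f (pref a b)) (comp f b).
Proof.
move=> Zf Zfa.
have fa c : eqv Z (comp f (off a c)) (comp f c).
  by rewrite /off -compA; apply: eqv_comp => j; apply: comp_anti_in.
by apply: eqv_trans (fa b); rewrite -off_pref; apply: eqv_sym.
Qed.

Lemma eqv_meet_out x y : ~ Z (meet x y) -> eqv Z (meet x y) x.
Proof. by move=> /(on_eqv x); rewrite on_meet. Qed.

End PrimeIdeal.

(** * Representation by classes modulo prime ideals *)

(** A canonical member of each class stands for the class. *)
Definition repr Z x : A := epsilon (carrier_nonempty A) (eqv Z x).

Lemma repr_eqv Z x : eqv Z x (repr Z x).
Proof.
by apply: (epsilon_spec (carrier_nonempty A)); exists x; exact: eqv_refl.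
Qed.

Lemma eq_repr Z x y : eqv Z x y -> repr Z x = repr Z y.
Proof.
move=> xy; congr epsilon; apply: funext => z; apply: propext.
by split; apply: eqv_trans => //; exact: eqv_sym.
Qed.

(** A prime ideal together with a class of elements outside it. *)
Definition point : Type :=
  {p : (A -> Prop) * A | [/\ prime_ideal p.1, repr p.1 p.2 = p.2 & ~ p.1 p.2]}.

Implicit Types (p q : point) (P : 'I_n -> point).

Definition ideal p : A -> Prop := (sval p).1.
Definition name p : A := (sval p).2.

Lemma ideal_prime p : prime_ideal (ideal p).
Proof. by case: p => ? []. Qed.

Lemma name_notin p : ~ ideal p (name p).
Proof. by case: p => ? []. Qed.

Lemma point_eq p q :
  ideal p = ideal q -> eqv (ideal q) (name p) (name q) -> p = q.
Proof.
case: p q => [[Z x] /= [Zp Zx Zx']] [[W y] /= [Wp Wy Wy']].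
rewrite /ideal /name /= => ZW xy; subst W; apply: eq_exist.
by rewrite -Zx -Wy (eq_repr xy).
Qed.

Lemma point_exists Z x : prime_ideal Z -> ~ Z x ->
  exists p, ideal p = Z /\ eqv Z x (name p).
Proof.
move=> Zp Zx.
have xP : [/\ prime_ideal Z, repr Z (repr Z x) = repr Z x & ~ Z (repr Z x)].
  split=> //; first by apply/eq_repr/eqv_sym/repr_eqv.
  by move=> Zr; apply: Zx; apply: prime_eqv Zr => //; apply/eqv_sym/repr_eqv.
by exists (exist _ (Z, repr Z x) xP); split=> //; exact: repr_eqv.
Qed.

Definition same_ideal p q : Prop := ideal p = ideal q.

(** [a] sends the classes of [f_1, ..., f_n] to the class of [comp f a]. The
    value [q] lies outside its ideal by the definition of points, which makes
    [theta a] undefined when [comp f a] lies in the ideal. *)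
Definition theta a : mrel n point := fun P q =>
  (forall i, ideal (P i) = ideal q) /\
  eqv (ideal q) (comp (fun i => name (P i)) a) (name q).

Let i0 : 'I_n := Ordinal n_gt0.

Lemma theta_out P q a :
  theta a P q -> ~ ideal q (comp (fun i => name (P i)) a).
Proof.
move=> [_ Pq] /(prime_eqv (ideal_prime q) Pq); exact: name_notin.
Qed.

Lemma theta_defined P Z a : (forall i, ideal (P i) = Z) ->
  (exists q, theta a P q) <-> ~ Z (comp (fun i => name (P i)) a).
Proof.
move=> PZ; split=> [[q aPq]|Za].
  by rewrite -(PZ i0) aPq.1; exact: theta_out.
have Zp : prime_ideal Z by rewrite -(PZ i0); exact: ideal_prime.
have [q [qZ aq]] := point_exists Zp Za; exists q.
by split=> [i|]; rewrite qZ.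
Qed.

Lemma theta_functional a : functional (theta a).
Proof.
move=> P q r [Pq aq] [Pr ar]; have qr : ideal q = ideal r by rewrite -(Pq i0).
by apply: point_eq => //; apply: eqv_trans ar; rewrite -qr; exact: eqv_sym.
Qed.

Lemma theta_entries a : equiv_entries same_ideal (theta a).
Proof. by move=> P q [Pq _]; split=> // i j; rewrite /same_ideal !Pq. Qed.

Lemma theta_comp f a :
  theta (comp f a) = fun_comp (fun i => theta (f i)) (theta a).
Proof.
apply: mrel_ext => P q; split=> [faPq|].
  have [Pq] := faPq; have /= := theta_out faPq.
  rewrite -compA => Zfa eq_fa; have Zp := ideal_prime q.
  have [Q Qf] : exists Q, forall i, theta (f i) P (Q i).
    apply: (fin_all_exists (P := fun i => theta (f i) P)) => i.
    apply/(theta_defined _ Pq) => Zi.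
    exact/Zfa/(prime_comp Zp a Zi).
  have QZ i : ideal (Q i) = ideal q by rewrite -((Qf i).1 i0).
  exists Q; split=> //; split=> //; apply: eqv_trans eq_fa.
  by apply: eqv_comp => i; rewrite -(QZ i); apply: eqv_sym; exact: (Qf i).2.
case=> Q [PQ [Qq aq]]; split=> [i|]; first by rewrite (PQ i0).1.
rewrite -compA; apply: eqv_trans aq; apply: eqv_comp => i.
by rewrite -(Qq i); exact: (PQ i).2.
Qed.

Lemma theta_anti i a : theta (anti i a) = fun_anti same_ideal i (theta a).
Proof.
apply: mrel_ext => P q; split=> [aPq|[-> Pgood Pa]].
  have [Pq iq] := aPq; have Zp := ideal_prime q.
  have Za : ideal q (comp (fun i => name (P i)) a).
    apply: contrapT => /(comp_anti_out Zp i) => Zi.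
    exact: theta_out aPq Zi.
  split.
  - apply/esym/point_eq => //; apply: eqv_trans iq; apply: eqv_sym.
    by apply: comp_anti_in => // j; rewrite -(Pq j); exact: name_notin.
  - by move=> j k; rewrite /same_ideal !Pq.
  - by move=> /(theta_defined _ Pq).
have PZ j : ideal (P j) = ideal (P i) := Pgood j i.
split=> //; apply: comp_anti_in; first exact: ideal_prime.
  by move=> j; rewrite -(PZ j); exact: name_notin.
by apply: contrapT => /(theta_defined _ PZ).
Qed.

Lemma theta_meet a b : theta (meet a b) = fun_meet (theta a) (theta b).
Proof.
apply: mrel_ext => P q; split=> [abPq|[[Pq aq] [_ bq]]].
  have [Pq] := abPq; have := theta_out abPq; rewrite comp_meet => Zab abq.
  have Zp := ideal_prime q; split; split=> //; apply: eqv_trans abq.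
    by apply: eqv_sym; apply: eqv_meet_out.
  by rewrite meetC in Zab *; apply: eqv_sym; apply: eqv_meet_out.
split=> //; rewrite comp_meet; apply: eqv_trans (aq); apply: eqv_meet.
by apply: eqv_trans aq _; exact: eqv_sym.
Qed.

Lemma theta_pref a b : theta (pref a b) = fun_pref (theta a) (theta b).
Proof.
apply: mrel_ext => P q.
have Zp := ideal_prime q.
have Pout :
    (forall i, ideal (P i) = ideal q) -> forall i, ~ ideal q (name (P i)).
  by move=> Pq i; rewrite -(Pq i); exact: name_notin.
split=> [[Pq abq]|[[Pq aq]|[Pa [Pq bq]]]].
- have [Pa|Pa] := pselect (exists r, theta a P r); [left|right; split=> //].
    split=> //; apply: eqv_trans abq; apply: eqv_sym.
    apply: comp_pref_out => //.
    exact/(theta_defined _ Pq).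
  split=> //; apply: eqv_trans abq; apply: eqv_sym; apply: comp_pref_in => //.
    exact: Pout.
  by apply: contrapT => /(theta_defined _ Pq).
- split=> //; apply: eqv_trans (aq); apply: comp_pref_out => //.
  by apply/(theta_defined _ Pq); exists q.
- split=> //; apply: eqv_trans bq; apply: comp_pref_in => //.
    exact: Pout.
  by apply: contrapT => /(theta_defined _ Pq).
Qed.

(** The classes of the projections: every element evaluates there to its own
    class, because [comp_proj] says that projections compose trivially. *)
Lemma projection_points Z : prime_ideal Z ->
  exists P, (forall i, ideal (P i) = Z) /\
    forall a, eqv Z (comp (fun i => name (P i)) a) a.
Proof.
move=> Zp.
have Zproj i : ~ Z (anti i zr).
  by move=> /(prime_anti Zp); apply; apply/(prime_zr Zp)/eqv_refl.
have [P PZ] := fin_all_exists (fun i => point_exists Zp (Zproj i)).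
exists P; split=> [i|a]; first exact: (PZ i).1.
rewrite -[X in eqv Z _ X]comp_proj; apply: eqv_comp => i.
by apply: eqv_sym; exact: (PZ i).2.
Qed.

Lemma theta_inj : injective theta.
Proof.
move=> a b ab; apply: contrapT => /prime_separation[Z Zp]; apply.
have [P [PZ Pid]] := projection_points Zp.
have Pab : (exists q, theta a P q) <-> (exists q, theta b P q) by rewrite ab.
have [Za|Za] := pselect (Z (comp (fun i => name (P i)) a)).
  have Zb : Z (comp (fun i => name (P i)) b).
    by apply: contrapT => /(theta_defined _ PZ)/Pab/(theta_defined _ PZ).
  apply: eqv_trans (eqv_sym (Pid a)) _; apply: eqv_trans (Pid b).
  move: Za Zb => /(mem_prime Zp) Za /(mem_prime Zp) Zb.
  exact: eqv_trans Za (eqv_sym Zb).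
have [q aq] := proj2 (theta_defined _ PZ) Za.
have bq : theta b P q by rewrite -ab.
have qZ : ideal q = Z by rewrite -(aq.1 i0).
move: aq.2 bq.2; rewrite qZ => aq2 bq2.
apply: eqv_trans (eqv_sym (Pid a)) _; apply: eqv_trans (Pid b).
exact: eqv_trans aq2 (eqv_sym bq2).
Qed.

Lemma same_ideal_equiv : RelationClasses.Equivalence same_ideal.
Proof. by split=> [p|p q|p q r] //; rewrite /same_ideal => ->. Qed.

Definition theta_algebra : function_algebra n.
Proof.
refine (@FunctionAlgebra n point same_ideal same_ideal_equiv
  (fun F => exists a, theta a = F) _ _ _ _ _ _ _).
- by exists (theta zr), zr.
- by move=> _ [a <-]; exact: theta_functional.
- by move=> _ [a <-]; exact: theta_entries.
- move=> F _ /fin_all_exists[f fF] [a <-]; exists (comp f a).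
  by rewrite theta_comp; congr fun_comp; apply: funext.
- by move=> i _ [a <-]; exists (anti i a); rewrite theta_anti.
- by move=> _ _ [a <-] [b <-]; exists (meet a b); rewrite theta_meet.
- by move=> _ _ [a <-] [b <-]; exists (pref a b); rewrite theta_pref.
Defined.

Lemma model_representable : representable A.
Proof.
exists theta_algebra.
pose h a : algebra_of theta_algebra := exist _ (theta a) (ex_intro _ a erefl).
exists h.
  split=> *; apply: eq_exist => /=.
  - exact: theta_comp.
  - exact: theta_anti.
  - exact: theta_meet.
  - exact: theta_pref.
exists (fun F : algebra_of theta_algebra => projT1 (cid (svalP F))) =>
  [a|[F aF]].
  by apply: theta_inj; case: cid.
by apply: eq_exist; case: cid.
Qed.

End Model.

(** * Soundness *)

Section Soundness.
Variables (n : nat) (n_gt0 : 0 < n) (X : Type) (E : X -> X -> Prop).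
Hypothesis equivE : RelationClasses.Equivalence E.

Implicit Types (f g : mrel n X) (x y : 'I_n -> X) (P Q : ('I_n -> X) -> Prop).
Implicit Types (i j k : 'I_n).

Let i0 : 'I_n := Ordinal n_gt0.

Definition good x : Prop := forall j k, E (x j) (x k).
Definition defined f x : Prop := exists z, f x z.
(** A partial projection. All values of [fun_anti] have this form, and they
    correspond to subsets of the set of [good] tuples. *)
Definition pid i P : mrel n X := fun x z => [/\ z = x i, good x & P x].
Definition restrict P f : mrel n X := fun x z => P x /\ f x z.

Lemma fun_antiE i f : fun_anti E i f = pid i (fun x => ~ defined f x).
Proof. by []. Qed.

(** An intermediate tuple of partial projections is the original tuple. This
    needs at least one argument, from which [P] can be read off. *)
Lemma fun_comp_pid P f : equiv_entries E f ->
  fun_comp (fun i => pid i P) f = restrict P f.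
Proof.
move=> Ef; apply: mrel_ext => x z; split=> [[y [xy yz]]|[Px xz]].
  have -> : x = y by apply: funext => i; case: (xy i).
  split=> //; have [_ _] := xy i0.
  by have -> : x = y by apply: funext => i; case: (xy i).
by exists x; split=> // i; split=> //; exact: (Ef _ _ xz).1.
Qed.

Lemma pid_entries i P : equiv_entries E (pid i P).
Proof. by move=> x z [-> gx _]; split. Qed.

Lemma fun_anti_entries i f : equiv_entries E (fun_anti E i f).
Proof. exact: pid_entries. Qed.

Lemma restrict_entries P f :
  equiv_entries E f -> equiv_entries E (restrict P f).
Proof. by move=> Ef x z [_ /Ef]. Qed.

Lemma restrict_pid P i Q : restrict P (pid i Q) = pid i (fun x => P x /\ Q x).
Proof. by apply: mrel_ext => x z; split=> [[? []]|[-> ? []]]. Qed.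

Lemma fun_anti_pid i j P : fun_anti E i (pid j P) = pid i (fun x => ~ P x).
Proof.
rewrite fun_antiE; apply: mrel_ext => x z; split=> -[-> gx Px]; split=> //.
  by move=> ?; apply: Px; exists (x j).
by case=> y [].
Qed.

Lemma defined_restrict P f x : defined (restrict P f) x <-> P x /\ defined f x.
Proof. by split=> [[y [? ?]]|[? [y ?]]]; [split=> //|]; exists y. Qed.

Lemma pid_eq i P Q : (forall x, good x -> P x <-> Q x) -> pid i P = pid i Q.
Proof. by move=> PQ; apply: mrel_ext => x z; split=> -[-> gx] /(PQ _ gx). Qed.

Definition fun_off f g : mrel n X := fun_comp (fun i => fun_anti E i f) g.
Definition fun_dom i f : mrel n X := fun_anti E i (fun_anti E i f).
Definition fun_on f g : mrel n X := fun_comp (fun i => fun_dom i f) g.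
Definition fun_plus i f g : mrel n X :=
  fun_anti E i (fun_off f (fun_anti E i g)).
Definition fun_bowtie i f g : mrel n X :=
  fun_plus i (fun_dom i (fun_meet f g)) (fun_off f (fun_anti E i g)).
Definition agree f g x : Prop :=
  defined (fun_meet f g) x \/ (~ defined f x /\ ~ defined g x).

Lemma fun_offE f g : equiv_entries E g ->
  fun_off f g = restrict (fun x => ~ defined f x) g.
Proof. exact: fun_comp_pid. Qed.

Lemma fun_domE i f : fun_dom i f = pid i (defined f).
Proof.
rewrite /fun_dom [fun_anti E i f]fun_antiE fun_anti_pid; apply: pid_eq => x _.
by split=> [|fx]; [exact: contrapT|apply].
Qed.

Lemma fun_onE f g : equiv_entries E g -> fun_on f g = restrict (defined f) g.
Proof.
move=> Eg; rewrite -fun_comp_pid //; congr fun_comp.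
by apply: funext => i; exact: fun_domE.
Qed.

Lemma fun_plusE i P Q :
  fun_plus i (pid i P) (pid i Q) = pid i (fun x => P x \/ Q x).
Proof.
rewrite /fun_plus fun_anti_pid fun_offE; last exact: pid_entries.
rewrite restrict_pid fun_anti_pid; apply: pid_eq => x gx.
have : defined (pid i P) x <-> P x.
  by split=> [[z []]|Px]; [|exists (x i)].
by have := classic (P x); have := classic (Q x); tauto.
Qed.

Lemma fun_bowtieE i f g : fun_bowtie i f g = pid i (agree f g).
Proof.
rewrite /fun_bowtie fun_domE fun_offE; last exact: fun_anti_entries.
by rewrite fun_antiE restrict_pid fun_plusE.
Qed.

(** From left to right, the intermediate tuples belonging to different [g i]
    coincide because the [f i] are functional, and at least one exists. *)
Lemma sound_compA (f g : 'I_n -> mrel n X) h : (forall i, functional (f i)) ->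
  fun_comp (fun i => fun_comp f (g i)) h = fun_comp f (fun_comp g h).
Proof.
move=> Ff; apply: mrel_ext => x z; split=> [[y [xy yz]]|[w [xw [y [wy yz]]]]].
  have [w [xw _]] := xy i0; exists w; split=> //; exists y; split=> // i.
  have [w' [xw' wy]] := xy i; suff -> : w = w' by [].
  by apply: funext => j; exact: Ff (xw j) (xw' j).
by exists y; split=> // i; exists w.
Qed.

Lemma fun_off_self f x z : ~ fun_off f f x z.
Proof.
case=> y [xy yz]; have [_ _] := xy i0; apply; exists z.
by have -> : x = y by apply: funext => i; case: (xy i).
Qed.

Lemma defined_off_self f x : ~ defined (fun_off f f) x.
Proof. by case=> z /fun_off_self. Qed.

Lemma fun_off_self_eq f g : fun_off f f = fun_off g g.
Proof. by apply: mrel_ext => x z; split=> /fun_off_self. Qed.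

Lemma sound_proj f g : equiv_entries E g ->
  fun_comp (fun i => fun_anti E i (fun_off f f)) g = g.
Proof.
move=> Eg; rewrite fun_comp_pid //; apply: mrel_ext => x z.
by split=> [[]//|xz]; split=> //; exact: defined_off_self.
Qed.

Lemma sound_zr_at (f : 'I_n -> mrel n X) i g h h' :
  f i = fun_off h h -> fun_comp f g = fun_off h' h'.
Proof.
move=> fi; apply: mrel_ext => x z; split=> [[y [/(_ i)]]|/fun_off_self//].
by rewrite fi => /fun_off_self.
Qed.

Lemma sound_comp0 (f : 'I_n -> mrel n X) h :
  fun_comp f (fun_off h h) = fun_off h h.
Proof.
apply: mrel_ext => x z.
by split=> [[y [_ /fun_off_self]]|/fun_off_self].
Qed.

Lemma sound_on_self f : equiv_entries E f -> fun_on f f = f.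
Proof.
move=> Ef; rewrite fun_onE //; apply: mrel_ext => x z.
by split=> [[]//|xz]; split=> //; exists z.
Qed.

Lemma sound_anti_antiC i j k f :
  fun_anti E i (fun_anti E j f) = fun_anti E i (fun_anti E k f).
Proof.
by rewrite [fun_anti E j f]fun_antiE [fun_anti E k f]fun_antiE !fun_anti_pid.
Qed.

Lemma sound_meetxx f : fun_meet f f = f.
Proof. by apply: mrel_ext => x z; split=> [[]|]. Qed.

Lemma sound_meetC f g : fun_meet f g = fun_meet g f.
Proof. by apply: mrel_ext => x z; split=> -[]. Qed.

Lemma sound_comp_meet (f : 'I_n -> mrel n X) g h :
  (forall i, functional (f i)) ->
  fun_comp f (fun_meet g h) = fun_meet (fun_comp f g) (fun_comp f h).
Proof.
move=> Ff; apply: mrel_ext => x z.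
split=> [[y [xy [yg yh]]]|[[y [xy yg]] [w [xw wh]]]].
  by split; exists y.
exists y; split=> //; split=> //; suff -> : y = w by [].
by apply: funext => i; exact: Ff (xy i) (xw i).
Qed.

Lemma sound_on_meet f g : equiv_entries E f -> functional f ->
  fun_on (fun_meet f g) f = fun_meet f g.
Proof.
move=> Ef Ff; rewrite fun_onE //; apply: mrel_ext => x z.
split=> [[[w [fw gw]] fz]|[fz gz]]; last by split=> //; exists z.
by rewrite (Ff _ _ _ fz fw).
Qed.

Lemma sound_on_pref f g : equiv_entries E f -> equiv_entries E g ->
  fun_on f (fun_pref f g) = f.
Proof.
move=> Ef Eg; have Efg : equiv_entries E (fun_pref f g).
  by move=> x z [/Ef|[_ /Eg]].
rewrite fun_onE //; apply: mrel_ext => x z; split=> [[fx [|[]]]//|fz].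
by split; [exists z|left].
Qed.

Lemma sound_off_pref f g : equiv_entries E f -> equiv_entries E g ->
  fun_off f (fun_pref f g) = fun_off f g.
Proof.
move=> Ef Eg; have Efg : equiv_entries E (fun_pref f g).
  by move=> x z [/Ef|[_ /Eg]].
rewrite !fun_offE //; apply: mrel_ext => x z; split=> -[fx].
  by case=> [fz|[]//]; case: fx; exists z.
by move=> gz; split=> //; right.
Qed.

(** The iterated domain restrictions confine [f i] to the tuples at which all
    [f j] are defined, so that there is a tuple of values to which [fun_anti]
    can be applied. *)
Lemma sound_comp_anti (f : 'I_n -> mrel n X) i g :
  (forall i, equiv_entries E (f i)) -> (forall i, functional (f i)) ->
  fun_comp f (fun_anti E i g) =
  fun_off (fun_comp f g)
    (foldr (fun j h => fun_on (f j) h) (f i) (enum 'I_n)).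
Proof.
move=> Ef Ff.
have Efold s : equiv_entries E (foldr (fun j h => fun_on (f j) h) (f i) s) /\
    foldr (fun j h => fun_on (f j) h) (f i) s =
    restrict (fun x => forall j, j \in s -> defined (f j) x) (f i).
  elim: s => [|j s [Es IHs]] /=.
    by split=> //; apply: mrel_ext => x z; split=> [|[]].
  rewrite fun_onE //; split; first exact: restrict_entries.
  rewrite IHs; apply: mrel_ext => x z; split=> [[fj [fs fi]]|[fs fi]].
    by split=> // k; rewrite inE => /predU1P[->|/fs].
  split; first by apply: fs; rewrite inE eqxx.
  by split=> // k ks; apply: fs; rewrite inE ks orbT.
have [Es ->] := Efold (enum 'I_n).
rewrite fun_offE; last exact: restrict_entries.
apply: mrel_ext => x z; split=> [[y [xy [-> gy ng]]]|[ng [fx fi]]].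
  split; last by split=> // j _; exists (y j).
  case=> w [y' [xy' yw]]; apply: ng; exists w; suff -> : y = y' by [].
  by apply: funext => j; exact: Ff (xy j) (xy' j).
have [y xy] : exists y : 'I_n -> X, forall j, f j x (y j).
  apply: (fin_all_exists (P := fun j => f j x)) => j.
  by apply: fx; rewrite mem_enum.
exists y; split=> //; split; first exact: Ff fi (xy i).
  move=> j k; have [_ xj] := Ef _ _ _ (xy j); have [_ xk] := Ef _ _ _ (xy k).
  by apply: (RelationClasses.Equivalence_Transitive _ (x i0)) (xk _); symmetry.
by case=> w yw; apply: ng; exists w, y.
Qed.

Lemma sound_comp_bowtie f g : equiv_entries E f -> equiv_entries E g ->
  functional f -> functional g ->
  fun_comp (fun i => fun_bowtie i f g) f =
  fun_comp (fun i => fun_bowtie i f g) g.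
Proof.
move=> Ef Eg Ff Fg.
have -> : (fun i => fun_bowtie i f g) = (fun i => pid i (agree f g)).
  by apply: funext => i; exact: fun_bowtieE.
rewrite !fun_comp_pid //; apply: mrel_ext => x z.
split=> -[fgx xz]; split=> //; case: (fgx) => [[w [fw gw]]|[nf ng]].
- by rewrite (Ff _ _ _ xz fw).
- by case: nf; exists z.
- by rewrite (Fg _ _ _ xz gw).
- by case: ng; exists z.
Qed.

(** Off the domain of [h], agreement of [f] and [g] is agreement of their
    restrictions. *)
Lemma sound_off_bowtie i f g h : equiv_entries E f -> equiv_entries E g ->
  fun_plus i (fun_off h (fun_dom i (fun_off h (fun_meet f g))))
    (fun_off h (fun_off (fun_off h f) (fun_anti E i (fun_off h g)))) =
  fun_off h (fun_bowtie i f g).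
Proof.
move=> Ef Eg.
have Efg : equiv_entries E (fun_meet f g) by move=> x z [/Ef].
rewrite fun_bowtieE fun_domE !fun_antiE.
rewrite !fun_offE //;
  try by [exact: pid_entries|apply: restrict_entries; exact: pid_entries].
rewrite !restrict_pid fun_plusE; apply: pid_eq => x _.
rewrite !defined_restrict /agree; have := classic (defined h x); tauto.
Qed.

Lemma sound_bowtie_split i f g h :
  fun_plus i (fun_on h (fun_bowtie i f g)) (fun_off h (fun_bowtie i f g)) =
  fun_bowtie i f g.
Proof.
rewrite fun_bowtieE fun_onE ?fun_offE; try exact: pid_entries.
rewrite !restrict_pid fun_plusE; apply: pid_eq => x _.
have := classic (defined h x); tauto.
Qed.

End Soundness.

Lemma function_algebra_axioms (n : nat) (n_gt0 : 0 < n) (F : function_algebra n)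
    (e : equation n) :
  List.In e (axioms n) -> satisfies (algebra_of F) e.
Proof.
have Ef (f : algebra_of F) : equiv_entries (@base_equiv n F) (sval f).
  exact: elem_entries (svalP f).
have Ff (f : algebra_of F) : functional (sval f).
  exact: elem_functional (svalP f).
have EF := base_equivP F.
have sval_inj (f g : algebra_of F) : sval f = sval g -> f = g.
  by case: f g => [f fF] [g gF] /= fg; exact: eq_exist.
move: e; apply/axiomsP; split; split.
- by move=> v; apply: sval_inj; exact: sound_compA.
- by move=> v; apply: sval_inj; exact: sound_proj.
- by move=> v; apply: sval_inj; exact: fun_off_self_eq.
- by move=> v; apply: sval_inj; exact: sound_comp0.
- by move=> v; apply: sval_inj; exact: sound_on_self.
- by move=> v; apply: sval_inj; exact: sound_meetxx.
- by move=> v; apply: sval_inj; exact: sound_meetC.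
- by move=> v; apply: sval_inj; exact: sound_comp_meet.
- by move=> v; apply: sval_inj; exact: sound_on_meet.
- by move=> v; apply: sval_inj; exact: sound_comp_bowtie.
- by move=> v; apply: sval_inj; exact: sound_on_pref.
- by move=> v; apply: sval_inj; exact: sound_off_pref.
- move=> i v; apply: sval_inj; apply: (sound_zr_at n_gt0 (i := i)) => /=.
  by rewrite eqxx.
- move=> i v; apply: sval_inj.
  rewrite /= sound_comp_anti //; congr fun_comp.
  by elim: (enum _) => //= j s ->.
- by move=> i j k v; apply: sval_inj; exact: sound_anti_antiC.
- by move=> i v; apply: sval_inj; exact: sound_off_bowtie.
- by move=> i v; apply: sval_inj; exact: sound_bowtie_split.
Qed.

Lemma representable_axioms (n : nat) (n_gt0 : 0 < n) (A : algebra n)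
    (e : equation n) :
  representable A -> List.In e (axioms n) -> satisfies A e.
Proof.
case=> F [h hh bijh] es.
exact: satisfies_sub hh (bij_inj bijh) (function_algebra_axioms n_gt0 es).
Qed.

Theorem theorem7p6 (n : nat) (n_gt0 : 0 < n) :
  variety (@representable n) /\ axiomatised_by (@representable n) (axioms n).
Proof.
have ax : axiomatised_by (@representable n) (axioms n).
  move=> A; split=> [rA e|axA]; first exact: representable_axioms.
  exact: model_representable.
split=> //; exact: axiomatised_variety ax.
Qed.
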